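(* Let $ABC$ be an anticlockwise oriented triangle and let a circle $\Gamma$ with centre $O$ meet the sides $BC$, $CA$, $AB$ at $\{A_1,A_2\}$, $\{B_1,B_2\}$, $\{C_1,C_2\}$ respectively. Let $P$ and $Q$ be the Miquel points of $\triangle A_1B_1C_1$ and $\triangle A_2B_2C_2$ in $\triangle ABC$, respectively. Put $T_A=PA_1\cap QA_2$, $T_B=PB_1\cap QB_2$, $T_C=PC_1\cap QC_2$. Let $A'$ be the second intersection (other than $A$) of $\odot(AB_1C_1)$ and $\odot(AB_2C_2)$, let $B'$ be the second intersection (other than $B$) of $\odot(BC_1A_1)$ and $\odot(BC_2A_2)$, and let $C'$ be the second intersection (other than $C$) of $\odot(CA_1B_1)$ and $\odot(CA_2B_2)$. Let $R$ be the pole with respect to $\Gamma$ of the line through the (collinear) points $A_0=B_1C_2\cap C_1B_2$, $B_0=A_1C_2\cap C_1A_2$, $C_0=A_1B_2\cap B_1A_2$. Then the ten points $P,Q,O,R,A',B',C',T_A,T_B,T_C$ lie on a circle.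
   Context: All objects lie in the Euclidean plane; $\odot(XYZ)$ denotes the circumcircle of $\triangle XYZ$. The two labels on each side may be assigned in either order. Miquel point: if $D,E,F$ lie on the lines $BC,CA,AB$ respectively, the Miquel point of $\triangle DEF$ in $\triangle ABC$ is the common point of $\odot(AEF)$, $\odot(BFD)$, $\odot(CDE)$. The points $A_0,B_0,C_0$ (intersections taken in the projective plane) are collinear by Pascal's theorem, and the lines $AA',BB',CC'$ meet at $R$. Coincidences are read in the limiting sense: if two points $X=Y$ of $\Gamma$ coincide, $XY$ means the tangent to $\Gamma$ at $X$; if, e.g., $B_1=A\neq C_1$, then $\odot(AB_1C_1)$ means the circle through $A$ and $C_1$ tangent to line $CA$ at $A$ (and similarly in the other cases). The configuration is assumed nondegenerate, so that every named object exists and is uniquely determined: no circle above has all three of its defining points equal, the second intersections $A',B',C'$ exist, $P\neq Q$, $P\notin\{A_1,B_1,C_1\}$, $Q\notin\{A_2,B_2,C_2\}$, the pairs of lines defining $T_A,T_B,T_C$ are distinct and not parallel, and the line $A_0B_0C_0$ is a line of the Euclidean plane not passing through $O$. *)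

(* Defs.v *)
From mathcomp Require Import all_boot all_order all_algebra.
From mathcomp Require Export classical_sets reals.

Set Implicit Arguments.
Unset Strict Implicit.
Unset Printing Implicit Defensive.

Import Order.TTheory GRing.Theory Num.Theory.

Local Open Scope ring_scope.
Local Open Scope classical_set_scope.

Definition dot {K : realType} {n : nat} (u v : 'rV[K]_n) : K := (u *m v^T) 0 0.

Section EuclideanPlane.
Variable K : realType.
Implicit Types A B C D E F O P X Y Z W R : 'rV[K]_2.

Definition anticlockwise A B C : Prop :=
  0 < (B - A) 0 0 * (C - A) 0 1 - (B - A) 0 1 * (C - A) 0 0.

(* A line only when X <> Y; it degenerates to a single point when X = Y. *)
Definition line X Y : set 'rV[K]_2 := [set Z | exists t : K, Z = X + t *: (Y - X)].

Definition circle O (r : K) : set 'rV[K]_2 := [set X | dot (X - O) (X - O) = r ^+ 2].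

Definition is_circle (k : set 'rV[K]_2) : Prop :=
  exists O (r : K), 0 < r /\ k = circle O r.

(* The set m is meant to be a line. *)
Definition tangent_at (k m : set 'rV[K]_2) X : Prop := k `&` m = [set X].

(* k is the circle AEF, for E on the line CA and F on the line AB, in the
   limiting sense: E = A means tangency to CA at A, and F = A means tangency to
   AB at A. (E = F with E <> A cannot occur, as CA and AB meet only at A.) *)
Definition vertex_circle A B C E F (k : set 'rV[K]_2) : Prop :=
  [/\ is_circle k, k A, k E & k F] /\
  (E = A -> tangent_at k (line C A) A) /\ (F = A -> tangent_at k (line A B) A).

(* For D, E, F on the lines BC, CA, AB respectively. *)
Definition miquel_point A B C D E F P : Prop :=
  exists kA kB kC : set 'rV[K]_2,
    [/\ vertex_circle A B C E F kA,
        vertex_circle B C A F D kB,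
        vertex_circle C A B D E kC &
        kA `&` kB `&` kC = [set P]].

(* X is the intersection other than A of the circles A E1 F1 and A E2 F2. *)
Definition second_intersection A B C E1 F1 E2 F2 X : Prop :=
  exists k1 k2 : set 'rV[K]_2,
    [/\ vertex_circle A B C E1 F1 k1,
        vertex_circle A B C E2 F2 k2,
        X <> A &
        k1 `&` k2 = [set A; X]].

(* Points and lines of the projective plane are given by nonzero vectors of
   homogeneous coordinates in K^3, up to scaling; the point p is on the line l
   when dot l p = 0. *)

Definition hom X : 'rV[K]_(2 + 1) := row_mx X 1%:M.

Definition affine_part (l : 'rV[K]_(2 + 1)) : set 'rV[K]_2 :=
  [set X | dot l (hom X) = 0].

Definition at_infinity (l : 'rV[K]_(2 + 1)) : Prop := lsubmx l = 0.

(* The line XY for X and Y on k, which is the tangent to k at X when X = Y. *)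
Definition chord (k : set 'rV[K]_2) X Y (l : 'rV[K]_(2 + 1)) : Prop :=
  [/\ l != 0, dot l (hom X) = 0, dot l (hom Y) = 0 &
      X = Y -> tangent_at k (affine_part l) X].

(* p is the only projective point on both lines; so the lines are distinct. *)
Definition proj_meet (l m p : 'rV[K]_(2 + 1)) : Prop :=
  p != 0 /\
  forall q, (dot l q = 0 /\ dot m q = 0) <-> (exists a : K, q = a *: p).

(* l is the only projective line through p, q and s; so these three points are
   collinear and not all equal. *)
Definition proj_join3 (p q s l : 'rV[K]_(2 + 1)) : Prop :=
  l != 0 /\
  forall m, [/\ dot m p = 0, dot m q = 0 & dot m s = 0] <->
            (exists a : K, m = a *: l).

(* p is the intersection of the lines XY and ZW, for X, Y, Z, W on k. *)
Definition chord_meet (k : set 'rV[K]_2) X Y Z W (p : 'rV[K]_(2 + 1)) : Prop :=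
  exists l m, [/\ chord k X Y l, chord k Z W m & proj_meet l m p].

(* The polar of R with respect to the circle of centre O and radius r. *)
Definition polar O (r : K) R : set 'rV[K]_2 :=
  [set X | dot (X - O) (R - O) = r ^+ 2].

(* The line l should neither pass through O nor be at infinity. *)
Definition is_pole O (r : K) (l : 'rV[K]_(2 + 1)) R : Prop :=
  polar O r R = affine_part l.

End EuclideanPlane.

(* Main.v *)
Require Import Defs.
From mathcomp Require Import all_boot all_order all_algebra.
From mathcomp Require Import classical_sets reals.
From mathcomp Require Import ring lra complex.

(** Take [Gamma] as the unit circle of the complex plane, centred at [0], and
    write [z'] for the conjugate of [z].  The side [BC] is then
    [z + a1 a2 z' = a1 + a2], tangency being the case [a1 = a2].  Since [P A1],
    [P B1], [P C1] make equal directed angles with the sides, there is a unit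
    [k] with [p - k p' a1 a2 = a1 - k a2] and likewise for [b] and [c].  These
    equations and their analogues for [Q] are linear, and uniqueness of their
    solution gives [q = - p / k].  Hence [0, p, q] lie on the circle
    [(1 - k) z z' = p z' - k p' z], whose centre is [m = p / (1 - k)].
    Eliminating between the two rotated lines gives [TA] on it.  The point [A']
    is the inverse of [A0] in [Gamma], and a combination of the equations for
    [b] and [c] shows that [A0] lies on the inverse of the circle, which is the
    polar line of [2 m].  So [A0 B0 C0] is that line, [R] is the antipode [2 m]
    of [O], and [A', B', C'] are on the circle. *)

Set Implicit Arguments.
Unset Strict Implicit.
Unset Printing Implicit Defensive.

Import Order.TTheory GRing.Theory Num.Theory.
Local Open Scope ring_scope.
Local Open Scope classical_set_scope.

(** * Equalities proved as explicit combinations of other equalities *)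

Section LinearCombinations.
Variable F : comPzRingType.
Implicit Types u v : F.

Lemma eq_mulL k u v : u = v -> k * u = k * v. Proof. by move->. Qed.

Lemma eq_addL u v u' v' : u = v -> u' = v' -> u + u' = v + v'.
Proof. by move=> -> ->. Qed.

(** Used for elimination: [x - y] is matched with an explicit combination of hypotheses, built by
    [eq_mulL] and [eq_addL], and [ring] or [field] checks the identity. *)
Lemma eq_of_diff x y u v : u = v -> x - y = u - v -> x = y.
Proof. by move=> ->; rewrite subrr => /eqP; rewrite subr_eq0 => /eqP. Qed.

End LinearCombinations.

(** * Eliminations in which conjugates (primed letters) are independent variables *)

Section FormalConjugates.
Variable F : fieldType.
Implicit Types a b c m p q s t w x k : F.

(** For a unit [c1], [c1 * x' - 1] is [c1] times the conjugate of [x - c1], so the conclusion is the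
    inscribed angle theorem: the lines from [x] to [b1] and [c1] form the same directed angle as the
    two sides. The side equations determine [a'], the centre equations [m']; the conclusion is then
    a multiple of [hx]. *)
Lemma vertex_circle_eq a a' b1 b2 c1 c2 m m' x x' :
  b1 * b2 != c1 * c2 ->
  a + b1 * b2 * a' = b1 + b2 -> a + c1 * c2 * a' = c1 + c2 ->
  m - b1 * b2 * m' = a - b2 -> m - c1 * c2 * m' = a - c2 ->
  x * x' - m' * x - m * x' = a * a' - m' * a - m * a' ->
  (x - b1) * (c1 * x' - 1) * c2 = (x - c1) * (b1 * x' - 1) * b2.
Proof.
move=> hD ab ac mb mc hx.
have D0 : c1 * c2 - b1 * b2 != 0 by rewrite subr_eq0 eq_sym.
have a'E : a' = (c1 + c2 - b1 - b2) / (c1 * c2 - b1 * b2).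
  apply: (mulIf D0); rewrite divfK //.
  by apply: (eq_of_diff (eq_addL ac (eq_mulL (-1) ab))); ring.
have m'E : m' = (c2 - b2) / (c1 * c2 - b1 * b2).
  apply: (mulIf D0); rewrite divfK //.
  by apply: (eq_of_diff (eq_addL mb (eq_mulL (-1) mc))); ring.
have aE : a = b1 + b2 - b1 * b2 * a' by rewrite -ab; ring.
have mE : m = a - b2 + b1 * b2 * m' by rewrite -mb; ring.
apply: (eq_of_diff (eq_mulL (c1 * c2 - b1 * b2) hx)).
by rewrite mE aE m'E a'E; field.
Qed.

(** Eliminating [x'] leaves an equation in [x] with the root [a]. Cancelling [x - a] isolates the
    other root, the centre of the spiral similarity taking [b1] to [c1] and [b2] to [c2]. *)
Lemma second_intersection_eq a a' b1 b2 c1 c2 x x' :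
  b1 * b2 != c1 * c2 ->
  a + b1 * b2 * a' = b1 + b2 -> a + c1 * c2 * a' = c1 + c2 -> x != a ->
  (x - b1) * (c1 * x' - 1) * c2 = (x - c1) * (b1 * x' - 1) * b2 ->
  (x - b2) * (c2 * x' - 1) * c1 = (x - c2) * (b2 * x' - 1) * b1 ->
  x * (b1 - b2 + c2 - c1) = b1 * c2 - b2 * c1.
Proof.
move=> hD ab ac xa h1 h2; set D := c1 * c2 - b1 * b2.
have D0 : D != 0 by rewrite subr_eq0 eq_sym.
have Dxa0 : D * (x - a) != 0 by rewrite mulf_neq0 // subr_eq0.
apply: (mulfI Dxa0).
have aE : D * a = c1 * c2 * (b1 + b2) - b1 * b2 * (c1 + c2).
  by apply: (eq_of_diff (eq_addL (eq_mulL (c1 * c2) ab)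
    (eq_mulL (- (b1 * b2)) ac))); rewrite /D; ring.
rewrite !mulrBr aE.
(* Each equation is multiplied, up to sign, by the coefficient of [x'] in the other one. *)
apply: (eq_of_diff (eq_addL
  (eq_mulL (- (D * x - b2 * c2 * (c1 - b1))) h1)
  (eq_mulL (D * x - b1 * c1 * (c2 - b2)) h2))).
by rewrite /D; ring.
Qed.

(** The coordinates [w], [w'], [t] are homogeneous, which allows points at infinity; [s] stands for
    [k * p']. This serves both for [A0], with its weight as [t], and for [A'], with [t = x * x']. *)
Lemma chord_meet_eq b1 b2 c1 c2 p s k w w' t :
  b1 - b2 + c2 - c1 != 0 ->
  p - s * (b1 * b2) = b1 - k * b2 -> p - s * (c1 * c2) = c1 - k * c2 ->
  w + b1 * c2 * w' = (b1 + c2) * t -> w + c1 * b2 * w' = (c1 + b2) * t ->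
  (1 - k) * t = p * w' - s * w.
Proof.
move=> N0 pb pc l1 l2; apply: (mulfI N0).
apply: (eq_of_diff (eq_addL
  (eq_addL (eq_mulL (- (c2 - c1) * w') pb)
           (eq_mulL (- (b1 - b2) * w') pc))
  (eq_addL (eq_mulL (- s * (c1 + b2) - (1 - k)) l1)
           (eq_mulL ((1 - k) + s * (b1 + c2)) l2)))).
ring.
Qed.

(** After division by [x * x'], the conclusion says that the inverse [1 / x'] of [x] in the unit
    circle is on the chord [b1 c2]. The equation for [x'] is the conjugate of that for [x], units
    having their inverses as conjugates. *)
Lemma second_intersection_chords b1 b2 c1 c2 x x' :
  b1 != 0 -> b2 != 0 -> c1 != 0 -> c2 != 0 -> b1 - b2 + c2 - c1 != 0 ->
  x * (b1 - b2 + c2 - c1) = b1 * c2 - b2 * c1 ->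
  x' * (b1^-1 - b2^-1 + c2^-1 - c1^-1) = b1^-1 * c2^-1 - b2^-1 * c1^-1 ->
  x + b1 * c2 * x' = (b1 + c2) * (x * x').
Proof.
move=> b10 b20 c10 c20 N0 xN x'N; apply: (mulfI N0).
apply: (eq_of_diff (eq_addL
  (eq_mulL (1 - (b1 + c2) * x') xN)
  (eq_mulL (b1 * c2 * b2 * c1) x'N))); field.
by rewrite c10 b20 c20.
Qed.

End FormalConjugates.

(** * Miquel rotations and the circle through the origin in the complex plane *)

Section ComplexPlane.
Variable C : numClosedFieldType.
Implicit Types a b c k m n p q s t u x y z : C.

Lemma unit_neq0 x : x * x^* = 1 -> x != 0.
Proof. by apply: contra_eq_neq => ->; rewrite mul0r eq_sym oner_neq0. Qed.

Lemma unit_conjC z : z * z^* = 1 -> z^* = z^-1.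
Proof.
by move=> zz; have z0 := unit_neq0 zz; apply: (mulfI z0); rewrite zz divff.
Qed.

(* [z + u z^* = const] is a line with direction [d] such that [d = - u d^*];
   reflecting in the line through [m] perpendicular to it sends [z] to
   [m + u (z - m)^*]. *)
Lemma circle_line_reflection m x y u :
  u * u^* = 1 ->
  (x - m) * (x - m)^* = (y - m) * (y - m)^* ->
  x + u * x^* = y + u * y^* ->
  (x = y -> forall z, (z - m) * (z - m)^* = (x - m) * (x - m)^* ->
     z + u * z^* = x + u * x^* -> z = x) ->
  y - m = u * (x - m)^*.
Proof.
move=> uu exy lxy tang; have [xy|xy] := eqVneq x y.
  (* In the tangent case the mirror image of [x] is on both the circle and the line, hence equal to
     [x]. *)
  have zc : (m + u * (x - m)^*)^* = m^* + u^* * (x - m).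
    by rewrite rmorphD rmorphM /= conjCK.
  suff zx : m + u * (x - m)^* = x by rewrite -xy; apply: (eq_of_diff (esym zx)); ring.
  apply: tang => //.
    rewrite [_ - m]addrAC subrr add0r rmorphM /= conjCK.
    by rewrite mulrACA uu mul1r mulrC.
  by rewrite zc mulrDr [u * (_ * _)]mulrA uu; ring.
have d0 : (y - x)^* != 0 by rewrite conjC_eq0 subr_eq0 eq_sym.
apply: (mulIf d0).
by apply: (eq_of_diff (eq_addL (eq_mulL (-1) exy) (eq_mulL (x - m)^* lxy))); ring.
Qed.

(* The lines [P A1], [P B1], [P C1] make equal directed angles with the
   respective sides; [- k] is the square of the corresponding rotation. *)
Lemma miquel_rotation p a1 a2 b1 b2 c1 c2 :
  a1 * a1^* = 1 -> a2 * a2^* = 1 -> b1 * b1^* = 1 -> c1 * c1^* = 1 -> p != a1 ->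
  (p - c1) * (a1 * p^* - 1) * a2 = (p - a1) * (c1 * p^* - 1) * c2 ->
  (p - a1) * (b1 * p^* - 1) * b2 = (p - b1) * (a1 * p^* - 1) * a2 ->
  exists k, [/\ k * k^* = 1,
    p - k * p^* * (a1 * a2) = a1 - k * a2,
    p - k * p^* * (b1 * b2) = b1 - k * b2 &
    p - k * p^* * (c1 * c2) = c1 - k * c2].
Proof.
move=> ua1 ua2 ub1 uc1 pa eB eC.
have a10 := unit_neq0 ua1; have a20 := unit_neq0 ua2.
have pa0 : p - a1 != 0 by rewrite subr_eq0.
have pa'0 : (p - a1)^* != 0 by rewrite conjC_eq0.
have den x : x * x^* = 1 -> x * p^* - 1 = x * (p - x)^*.
  by move=> xx; rewrite rmorphB mulrBr /= xx.
have d0 : a1 * p^* - 1 != 0 by rewrite den // mulf_neq0.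
(* This [k] solves the equation for [a1], [a2]; by [eC] and [eB] it solves the other two as well. *)
pose k := (p - a1) / (a2 * (a1 * p^* - 1)).
have k_of x y : (p - a1) * (x * p^* - 1) * y = (p - x) * (a1 * p^* - 1) * a2 ->
    p - k * p^* * (x * y) = x - k * y.
  move=> e; have : p - x = k * y * (x * p^* - 1).
    apply: (mulIf (mulf_neq0 d0 a20)); rewrite mulrA -e /k; field.
    by rewrite d0 a20.
  by move=> e'; apply: (eq_of_diff e'); ring.
exists k; split; [|by apply: k_of; ring|exact: k_of|exact: k_of].
rewrite /k den // rmorphM fmorphV !rmorphM /= conjCK.
rewrite (unit_conjC ua1) (unit_conjC ua2).
by field; rewrite pa0 -rmorphB pa'0 a10 a20.
Qed.

Lemma linear_system_unique u1 u2 u3 v1 v2 v3 x y z :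
  (u2 - u1) * (v3 - v1) - (u3 - u1) * (v2 - v1) != 0 ->
  x - y * u1 + z * v1 = 0 -> x - y * u2 + z * v2 = 0 -> x - y * u3 + z * v3 = 0 ->
  x = 0 /\ z = 0.
Proof.
move=> det e1 e2 e3.
have y0 : y = 0.
  apply: (mulfI det); rewrite mulr0.
  apply: (eq_of_diff (eq_addL (eq_addL (eq_mulL (v3 - v2) e1)
    (eq_mulL (v1 - v3) e2)) (eq_mulL (v2 - v1) e3))); ring.
have z0 : z = 0.
  apply: (mulfI det); rewrite mulr0.
  apply: (eq_of_diff (eq_addL (eq_addL (eq_mulL (u3 - u2) e1)
    (eq_mulL (u1 - u3) e2)) (eq_mulL (u2 - u1) e3))); ring.
by split=> //; rewrite -e1 y0 z0 !mul0r subr0 addr0.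
Qed.

(** Divided by [- k], the system for [p] becomes the system for [q], solved by [- p / k], [- s / k],
    [k^-1] in place of [q], [s'], [l]. The difference of the two systems is homogeneous with nonzero
    determinant. *)
Lemma miquel_opposite p q k l s s' a1 a2 b1 b2 c1 c2 :
  k != 0 ->
  (b1 * b2 - a1 * a2) * (c1 - a1) - (c1 * c2 - a1 * a2) * (b1 - a1) != 0 ->
  p - s * (a1 * a2) = a1 - k * a2 -> p - s * (b1 * b2) = b1 - k * b2 ->
  p - s * (c1 * c2) = c1 - k * c2 ->
  q - s' * (a2 * a1) = a2 - l * a1 -> q - s' * (b2 * b1) = b2 - l * b1 ->
  q - s' * (c2 * c1) = c2 - l * c1 ->
  q = - p / k /\ l = k^-1.
Proof.
move=> k0 det pa pb pc qa qb qc.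
have row x y : p - s * (x * y) = x - k * y -> q - s' * (y * x) = y - l * x ->
    (q + p / k) - (s' + s / k) * (x * y) + (l - k^-1) * x = 0.
  by move=> e e'; apply: (eq_of_diff (eq_addL (eq_mulL k^-1 e) e')); field.
have [] := linear_system_unique det (row _ _ pa qa) (row _ _ pb qb) (row _ _ pc qc).
move=> /eqP; rewrite addr_eq0 => /eqP-> /eqP.
by rewrite subr_eq0 => /eqP->; rewrite mulNr.
Qed.

Lemma pencil_det_neq0 m n a1 a2 b1 b2 c1 c2 b c :
  b1 * b2 != a1 * a2 -> c1 * c2 != a1 * a2 -> b != c ->
  m - c2 * c1 * m^* = b - c1 -> m - a2 * a1 * m^* = b - a1 ->
  n - a2 * a1 * n^* = c - a1 -> n - b2 * b1 * n^* = c - b1 ->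
  (b1 * b2 - a1 * a2) * (c1 - a1) - (c1 * c2 - a1 * a2) * (b1 - a1) != 0.
Proof.
move=> hb hc bc mc ma na nb; apply: contra_neq bc => det.
have d0 : (b1 * b2 - a1 * a2) * (c1 * c2 - a1 * a2) != 0.
  by rewrite mulf_neq0 // subr_eq0.
suff mn : m = n by apply: (@addIr _ (- a1)); rewrite -ma -na mn.
apply: (inv_inj (@conjCK _)); apply: (mulfI d0).
apply: (eq_of_diff (eq_addL det (eq_addL
  (eq_mulL (b1 * b2 - a1 * a2) (eq_addL ma (eq_mulL (-1) mc)))
  (eq_mulL (- (c1 * c2 - a1 * a2)) (eq_addL na (eq_mulL (-1) nb)))))).
by ring.
Qed.

(* The circle through [0] and [p] with centre [p / (1 - k)], when [k] is a
   unit other than [1]. *)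
Definition miquel_circle k p x : Prop :=
  (1 - k) * (x * x^*) = p * x^* - k * p^* * x.

Lemma miquel_center_conj k p m : k * k^* = 1 -> 1 - k != 0 ->
  m = p / (1 - k) -> m^* = - (k * p^*) / (1 - k).
Proof.
move=> kk k1 ->; have k0 := unit_neq0 kk.
rewrite rmorphM fmorphV rmorphB rmorph1 /= (unit_conjC kk).
have k2 : k - 1 != 0 by rewrite -opprB oppr_eq0.
by field; rewrite k0 k1 k2.
Qed.

Lemma miquel_circle_dist k p m x : k * k^* = 1 -> 1 - k != 0 ->
  m = p / (1 - k) -> miquel_circle k p x ->
  (x - m) * (x - m)^* = (0 - m) * (0 - m)^*.
Proof.
move=> kk k1 mE hx.
rewrite !rmorphB !rmorph0 /= (miquel_center_conj kk k1 mE) mE.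
by apply: (eq_of_diff (eq_mulL (1 - k)^-1 hx)); field.
Qed.

(** The inverse of [x] is on the chords [b1 c2] and [c1 b2]; for it, the line of [chord_meet_eq]
    becomes the circle equation for [x]. *)
Lemma miquel_circle_second_intersection b1 b2 c1 c2 k p x :
  b1 * b1^* = 1 -> b2 * b2^* = 1 -> c1 * c1^* = 1 -> c2 * c2^* = 1 ->
  p - k * p^* * (b1 * b2) = b1 - k * b2 -> p - k * p^* * (c1 * c2) = c1 - k * c2 ->
  b1 - b2 + c2 - c1 != 0 ->
  x * (b1 - b2 + c2 - c1) = b1 * c2 - b2 * c1 ->
  miquel_circle k p x.
Proof.
move=> ub1 ub2 uc1 uc2 pb pc N0 xN.
have := congr1 Num.conj xN.
rewrite !(rmorphM, rmorphB, rmorphD) /=.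
rewrite (unit_conjC ub1) (unit_conjC ub2) (unit_conjC uc1) (unit_conjC uc2) => x'N.
have [b10 b20] := (unit_neq0 ub1, unit_neq0 ub2).
have [c10 c20] := (unit_neq0 uc1, unit_neq0 uc2).
have l1 := second_intersection_chords b10 b20 c10 c20 N0 xN x'N.
apply: (chord_meet_eq N0 pb pc l1).
apply: (second_intersection_chords c10 c20 b10 b20).
- have -> : c1 - c2 + b2 - b1 = - (b1 - b2 + c2 - c1) by ring.
  by rewrite oppr_eq0.
- by apply: (eq_of_diff (eq_mulL (-1) xN)); ring.
- by apply: (eq_of_diff (eq_mulL (-1) x'N)); ring.
Qed.

(** The lines are turned by opposite angles from the side, so they meet on the perpendicular
    [t = a1 * a2 * t^*] to the side through [0]. This relation removes [a1 * a2] from [t^*] times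
    the difference of [t1] and [pa]. *)
Lemma miquel_circle_rotated_lines a1 a2 k p t : k != 0 -> 1 + k != 0 ->
  p - k * p^* * (a1 * a2) = a1 - k * a2 ->
  t - k * (a1 * a2) * t^* = a1 - k * a2 ->
  t - k^-1 * (a2 * a1) * t^* = a2 - k^-1 * a1 ->
  miquel_circle k p t.
Proof.
move=> k0 k1 pa t1 t2.
have tt : t = a1 * a2 * t^*.
  by apply: (mulfI k1); apply: (eq_of_diff (eq_addL t1 (eq_mulL k t2))); field.
apply: (eq_of_diff (eq_addL (eq_mulL t^* (eq_addL t1 (eq_mulL (-1) pa)))
  (eq_mulL (- (k * t^* - k * p^*)) tt))).
by ring.
Qed.

End ComplexPlane.

(** * Real coordinates of the plane *)

Lemma dot2E (K : realType) (u v : 'rV[K]_2) :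
  dot u v = u 0 0 * v 0 0 + u 0 1 * v 0 1.
Proof.
rewrite /dot mxE big_ord_recl big_ord1 !mxE.
by rewrite (_ : lift ord0 ord0 = 1) //; apply/val_inj.
Qed.

Lemma rV2P (K : realType) (u v : 'rV[K]_2) :
  u 0 0 = v 0 0 -> u 0 1 = v 0 1 -> u = v.
Proof.
move=> e0 e1; apply/rowP => -[[|[|//]] i2].
- by rewrite (_ : Ordinal i2 = 0) //; apply/val_inj.
- by rewrite (_ : Ordinal i2 = 1) //; apply/val_inj.
Qed.

Lemma dot2_ge0 (K : realType) (u : 'rV[K]_2) : 0 <= dot u u.
Proof. by rewrite dot2E -!expr2 addr_ge0 ?sqr_ge0. Qed.

Lemma dot2_eq0 (K : realType) (u : 'rV[K]_2) : dot u u = 0 -> u = 0.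
Proof.
rewrite dot2E -!expr2 => /eqP; rewrite paddr_eq0 ?sqr_ge0 //.
by rewrite !sqrf_eq0 => /andP[/eqP e0 /eqP e1]; apply: rV2P; rewrite ?e0 ?e1 mxE.
Qed.

Lemma conj_complex (K : rcfType) (a b : K) : ((a +i* b)%C)^* = (a -i* b)%C.
Proof. by []. Qed.

(** * Complex coordinates in which the given circle is the unit circle *)

Section UnitCircle.
Variables (K : realType) (O : 'rV[K]_2) (r : K).
Hypothesis r_gt0 : 0 < r.
Let r_neq0 : r != 0. Proof. by rewrite gt_eqF. Qed.

Implicit Types A B C E F M X Y Z : 'rV[K]_2.

Definition affix X : complex K := (((X - O) 0 0 / r) +i* ((X - O) 0 1 / r))%C.

Lemma affix_O : affix O = 0.
Proof. by rewrite /affix !mxE !subrr !mul0r. Qed.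

Lemma affix_inj : injective affix.
Proof.
move=> X Y [] /(mulIf (invr_neq0 r_neq0)) e0 /(mulIf (invr_neq0 r_neq0)) e1.
by apply: (@addIr _ (- O)); apply: rV2P.
Qed.

Lemma affix_surj z : exists X, affix X = z.
Proof.
case: z => a b; exists (O + \row_j (if j == 0 then r * a else r * b)).
by rewrite /affix !mxE /=; congr Complex; field.
Qed.

Lemma affix_dot X Y Z W :
  (affix X - affix Y) * (affix Z - affix W)^* +
  (affix X - affix Y)^* * (affix Z - affix W) =
  (2 * dot (X - Y) (Z - W) / r ^+ 2)%:C%C.
Proof.
by rewrite dot2E /affix !mxE !conj_complex; simpc; congr Complex; field.
Qed.

Lemma affix_cross X Y Z W :
  (affix X - affix Y) * (affix Z - affix W)^* -
  (affix X - affix Y)^* * (affix Z - affix W) =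
  (- (2 * ((X - Y) 0 0 * (Z - W) 0 1 - (X - Y) 0 1 * (Z - W) 0 0) / r ^+ 2) *i)%C.
Proof.
by rewrite /affix !mxE !conj_complex; simpc; congr Complex; field.
Qed.

Lemma affix_norm X Y :
  (affix X - affix Y) * (affix X - affix Y)^* = (dot (X - Y) (X - Y) / r ^+ 2)%:C%C.
Proof.
by rewrite dot2E /affix !mxE !conj_complex; simpc; congr Complex; field.
Qed.

Lemma affix_eqdist X Y M N :
  dot (X - M) (X - M) = dot (Y - N) (Y - N) <->
  (affix X - affix M) * (affix X - affix M)^* =
  (affix Y - affix N) * (affix Y - affix N)^*.
Proof.
rewrite !affix_norm; split=> [->//|/complexI].
by apply: mulIf; rewrite invr_neq0 // expf_neq0.
Qed.

Lemma circle_affixP X : circle O r X <-> affix X * (affix X)^* = 1.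
Proof.
have := affix_norm X O; rewrite affix_O !subr0 => ->; rewrite /circle /=.
have r20 : r ^+ 2 != 0 by rewrite expf_neq0.
split=> [->|/(congr1 (@complex.Re K)) /= e]; first by rewrite divff.
by rewrite -[LHS](divfK r20) e mul1r.
Qed.

(** Multiplied by [(affix Y - affix X)^*], the equation says that the cross product of [Z - X] and
    [Y - X] vanishes. *)
Lemma line_affixP X Y Z (u : complex K) : X <> Y ->
  u = - (affix Y - affix X) / (affix Y - affix X)^* ->
  line X Y Z <-> affix Z + u * (affix Z)^* = affix X + u * (affix X)^*.
Proof.
move=> XY uE; have d0 : affix Y - affix X != 0.
  by rewrite subr_eq0; apply/eqP => /affix_inj/esym.
have dc0 : (affix Y - affix X)^* != 0 by rewrite conjC_eq0.
have cr : affix Z + u * (affix Z)^* = affix X + u * (affix X)^* <->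
    (affix Z - affix X) * (affix Y - affix X)^* -
    (affix Z - affix X)^* * (affix Y - affix X) = 0.
  have -> : (affix Z - affix X) * (affix Y - affix X)^* -
    (affix Z - affix X)^* * (affix Y - affix X) =
    (affix Y - affix X)^* *
      ((affix Z + u * (affix Z)^*) - (affix X + u * (affix X)^*)).
    by rewrite uE; field; rewrite -rmorphB.
  split=> [->|/eqP]; first by rewrite subrr mulr0.
  by rewrite mulf_eq0 (negbTE dc0) /= subr_eq0 => /eqP.
rewrite cr affix_cross; split=> [[t ->]|].
  by rewrite !mxE; simpc; congr Complex; ring.
move/(congr1 (@complex.Im K)) => /= /eqP.
rewrite oppr_eq0 mulf_eq0 invr_eq0 expf_eq0 /= (negbTE r_neq0) orbF.
rewrite mulf_eq0 pnatr_eq0 /= subr_eq0 => /eqP e.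
have D0 : dot (Y - X) (Y - X) != 0.
  apply/eqP => /dot2_eq0 e0; apply: XY; apply/eqP.
  by rewrite eq_sym -subr_eq0 e0.
(* The parameter of the orthogonal projection of [Z] onto the line. *)
exists (dot (Z - X) (Y - X) / dot (Y - X) (Y - X)).
apply: (@addIr _ (- X)); rewrite [RHS]addrAC subrr add0r.
rewrite -[RHS](scalerK D0) -[LHS](scalerK D0); congr (_ *: _).
move: e; rewrite scalerA [_ * (_ / _)]mulrC divfK // !dot2E !mxE => e.
apply: rV2P; rewrite !mxE.
  apply: (eq_of_diff (eq_mulL (Y 0 1 - X 0 1) e)); ring.
by apply: (eq_of_diff (eq_mulL (- (Y 0 0 - X 0 0)) e)); ring.
Qed.

(* [S] is the line [xy], meaning the tangent at [x] when [x = y]. *)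
Definition chord_line (S : set 'rV[K]_2) (x y : complex K) : Prop :=
  [/\ x * x^* = 1, y * y^* = 1 &
      forall Z, S Z <-> affix Z + x * y * (affix Z)^* = x + y].

Lemma chord_lineC S x y : chord_line S x y -> chord_line S y x.
Proof. by case=> xx yy S_xy; split=> // Z; rewrite S_xy [y * x]mulrC [y + x]addrC. Qed.

Lemma chord_line_left S X y : chord_line S (affix X) y -> S X.
Proof. by case=> xx _ ->; rewrite mulrAC xx mul1r. Qed.

Lemma unit_line_slope (d : complex K) :
  d != 0 -> (- d / d^*) * (- d / d^*)^* = 1.
Proof.
move=> d0; have dc0 : d^* != 0 by rewrite conjC_eq0.
by rewrite rmorphM rmorphN fmorphV /= conjCK; field; rewrite d0 dc0.
Qed.

Lemma unit_mul_conj (x y u : complex K) : x * x^* = 1 ->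
  y - 0 = u * (x - 0)^* -> u = x * y.
Proof. by rewrite !subr0 => xx ->; rewrite mulrCA xx mulr1. Qed.

(** Reflection in the perpendicular to [BC] through [O] exchanges [X] and [Y], so the slope [u] of
    the side is the product of their affixes. When [X = Y], tangency holds because the intersection
    is a single point. *)
Lemma side_chord_line B C X Y : B <> C ->
  circle O r `&` line B C = [set X; Y] ->
  chord_line (line B C) (affix X) (affix Y).
Proof.
move=> BC h.
have [cX lX] : (circle O r `&` line B C) X by rewrite h; left.
have [cY lY] : (circle O r `&` line B C) Y by rewrite h; right.
have d0 : affix C - affix B != 0.
  by rewrite subr_eq0; apply/eqP => /affix_inj/esym.
pose u := - (affix C - affix B) / (affix C - affix B)^*.
have lP Z := line_affixP Z BC (erefl u).
move: (lX) (lY) => /lP uX /lP uY.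
move: (cX) (cY) => /circle_affixP xx /circle_affixP yy.
have /(unit_mul_conj xx) uE : affix Y - 0 = u * (affix X - 0)^*.
  apply: circle_line_reflection; first exact: unit_line_slope.
  - by rewrite !subr0 xx yy.
  - by rewrite uX uY.
  - move=> /affix_inj XY z; rewrite !subr0 uX xx => zz uz.
    have [Z ZE] := affix_surj z; rewrite -ZE; congr affix.
    have : (circle O r `&` line B C) Z.
      by split; [apply/circle_affixP; rewrite ZE|apply/lP; rewrite ZE].
    by rewrite h -XY => -[].
split=> // Z; rewrite -uE lP -uX.
have -> : u * (affix X)^* = affix Y by rewrite uE mulrAC xx mul1r.
by [].
Qed.

(** Reflection in the perpendicular to [L] through [M] takes [A] to [E], in the tangent case too;
    the equation of [L] at [A] then removes the conjugate of [affix A]. *)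
Lemma vertex_center_side M (rho : K) L A E y :
  chord_line L (affix E) y -> L A ->
  circle M rho A -> circle M rho E ->
  (E = A -> tangent_at (circle M rho) L A) ->
  affix M - affix E * y * (affix M)^* = affix A - y.
Proof.
move=> chL LA kA kE tan; have LE := chord_line_left chL.
have [xx yy LP] := chL; move: (LA) (LE) => /LP uA /LP uE.
have dist Z : circle M rho Z <->
    (affix Z - affix M) * (affix Z - affix M)^* =
    (affix A - affix M) * (affix A - affix M)^*.
  by rewrite -affix_eqdist -[circle M rho Z]/(dot (Z - M) (Z - M) = rho ^+ 2) kA.
have : affix E - affix M = affix E * y * (affix A - affix M)^*.
  apply: circle_line_reflection.
  - by rewrite rmorphM /= mulrACA xx yy mulr1.
  - by apply/esym/dist.
  - by rewrite uA uE.
  - move=> /affix_inj AE z; have [Z <-] := affix_surj z => /dist kZ.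
    rewrite uA => /LP LZ; congr affix.
    by have : (circle M rho `&` L) Z by []; rewrite tan // => ->.
rewrite rmorphB mulrBr /= => e.
by apply: (eq_of_diff (eq_addL (eq_mulL (-1) e) (eq_mulL (-1) uA))); ring.
Qed.

Lemma line_left A B : line A B A.
Proof. by exists 0; rewrite scale0r addr0. Qed.

Lemma line_right A B : line A B B.
Proof. by exists 1; rewrite scale1r addrC subrK. Qed.

Lemma vertex_circle_center A B C E F k e' f' :
  chord_line (line C A) (affix E) e' -> chord_line (line A B) (affix F) f' ->
  vertex_circle A B C E F k ->
  exists M (rho : K), [/\ 0 < rho, k = circle M rho,
    affix M - affix E * e' * (affix M)^* = affix A - e' &
    affix M - affix F * f' * (affix M)^* = affix A - f'].
Proof.
move=> chE chF [[[M [rho [rho0 ->]]] kA kE kF] [tE tF]].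
exists M, rho; split=> //.
  exact: vertex_center_side chE (line_right _ _) kA kE tE.
exact: vertex_center_side chF (line_left _ _) kA kF tF.
Qed.

Lemma chord_lines_not_parallel A B C b1 b2 c1 c2 :
  ~ line A B C ->
  chord_line (line C A) b1 b2 -> chord_line (line A B) c1 c2 ->
  b1 * b2 != c1 * c2.
Proof.
move=> ABC [_ _ CA] [_ _ AB]; apply/eqP => e; apply: ABC; apply/AB.
move: (line_left C A) (line_right C A) (line_left A B) => /CA cC /CA cA /AB <-.
by rewrite -e cC cA.
Qed.

Lemma vertex_circle_affix A B C E F k e' f' X :
  ~ line A B C ->
  chord_line (line C A) (affix E) e' -> chord_line (line A B) (affix F) f' ->
  vertex_circle A B C E F k -> k X ->
  (affix X - affix E) * (affix F * (affix X)^* - 1) * f' =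
  (affix X - affix F) * (affix E * (affix X)^* - 1) * e'.
Proof.
move=> ABC chE chF vk kX.
have [M [rho [_ kE mE mF]]] := vertex_circle_center chE chF vk.
have [[_ _ LE] [_ _ LF]] := (chE, chF).
have kA : k A by case: vk => -[].
apply: (vertex_circle_eq (chord_lines_not_parallel ABC chE chF) _ _ mE mF).
- by apply/LE/line_right.
- by apply/LF/line_left.
have /affix_eqdist e : dot (X - M) (X - M) = dot (A - M) (A - M).
  by move: kX kA; rewrite kE => -> ->.
move: e; rewrite !rmorphB /= => e.
by apply: (eq_of_diff e); ring.
Qed.

(** Three of the points where the circle meets the axes through [M] are distinct, too many for a
    pair. *)
Lemma circle_not_pair M (rho : K) A X : 0 < rho -> circle M rho <> [set A; X].
Proof.
move=> rho0 h.
have mem (v : 'rV[K]_2) : dot v v = rho ^+ 2 -> M + v = A \/ M + v = X.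
  move=> vv; have : circle M rho (M + v).
    by rewrite /circle /= addrAC subrr add0r.
  by rewrite h.
pose v (a b : K) : 'rV[K]_2 := \row_j (if j == 0 then a else b).
have vE a b : dot (v a b) (v a b) = a ^+ 2 + b ^+ 2.
  by rewrite dot2E !mxE /= !expr2.
have inj a b c d : M + v a b = M + v c d -> a = c /\ b = d.
  move=> /addrI /rowP e.
  by split; [have := e 0|have := e 1]; rewrite !mxE.
have n0 : rho <> - rho by move=> e; lra.
have [e1 e2 e3] : [/\ M + v rho 0 = A \/ M + v rho 0 = X,
    M + v (- rho) 0 = A \/ M + v (- rho) 0 = X &
    M + v 0 rho = A \/ M + v 0 rho = X].
  by split; apply: mem; rewrite vE; ring.
have d12 : M + v rho 0 <> M + v (- rho) 0 by move=> /inj[].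
have d13 : M + v rho 0 <> M + v 0 rho by move=> /inj[e _]; lra.
have d23 : M + v (- rho) 0 <> M + v 0 rho by move=> /inj[e _]; lra.
by case: e1 => e1; case: e2 => e2; case: e3 => e3;
  [apply: d12; rewrite e1|apply: d12; rewrite e1|apply: d13; rewrite e1|
   apply: d23; rewrite e2|apply: d23; rewrite e2|apply: d13; rewrite e1|
   apply: d12; rewrite e1|apply: d12; rewrite e1].
Qed.

End UnitCircle.

Lemma anticlockwise_rotate (K : realType) (A B C : 'rV[K]_2) :
  anticlockwise A B C -> anticlockwise B C A.
Proof. by rewrite /anticlockwise !mxE => h; lra. Qed.

Lemma anticlockwise_not_line (K : realType) (A B C : 'rV[K]_2) :
  anticlockwise A B C -> ~ line A B C.
Proof.
rewrite /anticlockwise => h [t Ct]; move: h; rewrite Ct !mxE.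
by rewrite (_ : _ - _ = 0) ?ltxx //; ring.
Qed.

Lemma anticlockwise_neq (K : realType) (A B C : 'rV[K]_2) :
  anticlockwise A B C -> A <> B.
Proof.
by rewrite /anticlockwise => + e; rewrite e !mxE !subrr !mul0r subrr ltxx.
Qed.

Lemma dot_block (K : realType) (l q : 'rV[K]_(2 + 1)) :
  dot l q = dot (lsubmx l) (lsubmx q) + rsubmx l 0 0 * rsubmx q 0 0.
Proof.
rewrite /dot -{1}[l]hsubmxK -{1}[q]hsubmxK tr_row_mx mul_row_col mxE; congr (_ + _).
by rewrite mxE big_ord1 !mxE.
Qed.

(** * Chords, their projective intersections, and poles in complex coordinates *)

Section ProjectivePoints.
Variables (K : realType) (O : 'rV[K]_2) (r : K).
Hypothesis r_gt0 : 0 < r.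
Let r_neq0 : r != 0. Proof. by rewrite gt_eqF. Qed.

Implicit Types A B C E F M X Y Z P Q : 'rV[K]_2.
Implicit Types l q : 'rV[K]_(2 + 1).

Local Notation affix := (affix O r).
Local Notation chord_line := (chord_line O r).

Definition weight q : K := rsubmx q 0 0.

(* [weight q * affix X] when [q] represents the affine point [X]. *)
Definition proj_affix q : complex K :=
  (((lsubmx q - weight q *: O) 0 0 / r) +i* ((lsubmx q - weight q *: O) 0 1 / r))%C.

Lemma weight_hom X : weight (Defs.hom X) = 1.
Proof. by rewrite /weight /Defs.hom row_mxKr mxE. Qed.

Lemma proj_affix_hom X : proj_affix (Defs.hom X) = affix X.
Proof. by rewrite /proj_affix weight_hom scale1r /Defs.hom row_mxKl. Qed.

Lemma dot_proj_affix l q :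
  let n := (lsubmx l 0 0 +i* lsubmx l 0 1)%C in
  n^* * proj_affix q + n * (proj_affix q)^* +
    (2 * dot l (Defs.hom O) / r)%:C%C * (weight q)%:C%C =
  (2 * dot l q / r)%:C%C.
Proof.
rewrite /= !dot_block !dot2E -!/(weight _) weight_hom row_mxKl /proj_affix.
by rewrite !conj_complex !mxE; simpc; congr Complex; field.
Qed.

Lemma chord_proj_affix X Y l q :
  circle O r X -> circle O r Y -> chord (circle O r) X Y l -> dot l q = 0 ->
  proj_affix q + affix X * affix Y * (proj_affix q)^* =
  (affix X + affix Y) * (weight q)%:C%C.
Proof.
move=> cX cY [l0 lX lY tan] lq.
set n : complex K := (lsubmx l 0 0 +i* lsubmx l 0 1)%C.
have [s nP] : exists s, forall p, dot l p = 0 <->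
    n^* * proj_affix p + n * (proj_affix p)^* + s * (weight p)%:C%C = 0.
  exists (2 * dot l (Defs.hom O) / r)%:C%C => p.
  rewrite /n dot_proj_affix; split=> [->|]; first by rewrite mulr0 mul0r.
  move/(congr1 (@complex.Re K)) => /= /eqP.
  by rewrite mulf_eq0 invr_eq0 (negbTE r_neq0) orbF mulf_eq0 pnatr_eq0 /= => /eqP.
have hP Z : dot l (Defs.hom Z) = 0 <-> n^* * affix Z + n * (affix Z)^* + s = 0.
  by rewrite nP proj_affix_hom weight_hom mulr1.
(* With a zero normal, incidence with [X] would make the last coordinate of [l] vanish too. *)
have n0 : n != 0.
  apply: contra_neq l0 => nE; have [e0 e1] : lsubmx l 0 0 = 0 /\ lsubmx l 0 1 = 0.
    by split; [have := congr1 (@complex.Re K) nE|have := congr1 (@complex.Im K) nE].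
  have := lX; rewrite dot_block dot2E e0 e1 !mul0r !add0r -/(weight (Defs.hom X)).
  rewrite weight_hom mulr1 => e2.
  rewrite -[l]hsubmxK -[RHS](@row_mx0 _ 1 2 1); congr row_mx.
    by apply: rV2P; rewrite ?e0 ?e1 mxE.
  by apply/rowP => i; rewrite ord1 e2 mxE.
have nc0 : n^* != 0 by rewrite conjC_eq0.
pose u := n / n^*.
have uu : u * u^* = 1.
  by rewrite /u rmorphM fmorphV /= conjCK; field; rewrite n0 nc0.
have [xx yy] : affix X * (affix X)^* = 1 /\ affix Y * (affix Y)^* = 1.
  by split; apply/circle_affixP.
have lineP Z : dot l (Defs.hom Z) = 0 <->
    affix Z + u * (affix Z)^* = affix X + u * (affix X)^*.
  rewrite hP; move/hP: lX => lX; split=> e.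
    apply: (mulfI nc0); apply: (eq_of_diff (eq_addL e (eq_mulL (-1) lX))).
    by rewrite /u; field.
  by apply: (eq_of_diff (eq_addL lX (eq_mulL (n^*) e))); rewrite /u; field.
(* As for the sides, a reflection identifies [u] with the product of the two affixes; for [X = Y]
   the tangency clause of [chord] is used. *)
have /(unit_mul_conj xx) uE : affix Y - 0 = u * (affix X - 0)^*.
  apply: circle_line_reflection => //.
  - by rewrite !subr0 xx yy.
  - by apply/esym/lineP.
  - move=> /(affix_inj r_gt0) XY z.
    have [Z <-] := affix_surj O r_gt0 z.
    rewrite !subr0 xx => /(circle_affixP O r_gt0) cZ /lineP lZ; congr affix.
    by have : (circle O r `&` affine_part l) Z by []; rewrite (tan XY).
move/nP: lq => lq; move/hP: lX => lX.
apply: (mulfI nc0); rewrite -uE.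
apply: (eq_of_diff (eq_addL lq (eq_mulL (- (weight q)%:C%C) lX))).
have -> : affix Y = u * (affix X)^* by rewrite uE mulrAC xx mul1r.
by rewrite /u; field.
Qed.

Lemma chord_meet_proj_affix X Y Z W q :
  circle O r X -> circle O r Y -> circle O r Z -> circle O r W ->
  chord_meet (circle O r) X Y Z W q ->
  proj_affix q + affix X * affix Y * (proj_affix q)^* =
    (affix X + affix Y) * (weight q)%:C%C /\
  proj_affix q + affix Z * affix W * (proj_affix q)^* =
    (affix Z + affix W) * (weight q)%:C%C.
Proof.
move=> cX cY cZ cW [l [m [chl chm [_ lmq]]]].
have [lq mq] : dot l q = 0 /\ dot m q = 0 by apply/lmq; exists 1; rewrite scale1r.
by split; [apply: chord_proj_affix chl lq|apply: chord_proj_affix chm mq].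
Qed.

Lemma second_intersection_affix A B C E1 F1 E2 F2 X :
  ~ line A B C ->
  chord_line (line C A) (affix E1) (affix E2) ->
  chord_line (line A B) (affix F1) (affix F2) ->
  second_intersection A B C E1 F1 E2 F2 X ->
  affix E1 - affix E2 + affix F2 - affix F1 != 0 /\
  affix X * (affix E1 - affix E2 + affix F2 - affix F1) =
    affix E1 * affix F2 - affix E2 * affix F1.
Proof.
move=> ABC chE chF [k1 [k2 [v1 v2 XA k12]]].
have [k1X k2X] : k1 X /\ k2 X by have : (k1 `&` k2) X by rewrite k12; right.
have [chE' chF'] := (chord_lineC chE, chord_lineC chF).
have D0 := chord_lines_not_parallel ABC chE chF.
have e1 := vertex_circle_affix r_gt0 ABC chE chF v1 k1X.
have e2 := vertex_circle_affix r_gt0 ABC chE' chF' v2 k2X.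
have [[_ _ LE] [_ _ LF]] := (chE, chF).
split; last first.
  apply: (second_intersection_eq D0 _ _ _ e1 e2).
  - by apply/LE/line_right.
  - by apply/LF/line_left.
  - by apply/eqP => /(affix_inj r_gt0).
(* If this vanished, the two circles would have the same centre; both passing through [A], they
   would be equal and meet in more than a pair. *)
apply/eqP => N0.
have [M [rho [rho0 k1E mE mF]]] := vertex_circle_center r_gt0 chE chF v1.
have [N [sig [_ k2E nE nF]]] := vertex_circle_center r_gt0 chE' chF' v2.
have MN : M = N.
  apply: (affix_inj r_gt0 (O := O)); apply: (inv_inj (@conjCK _)).
  have d0 : affix E1 * affix E2 - affix F1 * affix F2 != 0 by rewrite subr_eq0.
  apply: (mulfI d0); apply: (eq_of_diff (eq_addL
    (eq_addL (eq_mulL (-1) mE) mF)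
    (eq_addL (eq_addL nE (eq_mulL (-1) nF)) (eq_mulL (-1) N0)))).
  by ring.
have [k1A k2A] : k1 A /\ k2 A by have : (k1 `&` k2) A by rewrite k12; left.
have k21 : k2 = k1.
  by move: k1A k2A; rewrite k1E k2E MN /circle /= => -> ->.
by move: k12; rewrite k21 setIid k1E; exact: circle_not_pair.
Qed.

(** With [e], [p] the affixes of [E], [P], the relations [pE] and [xx] give
    [e - p = k * e * y * (e - p)^*], which determines the slope of [PE]. *)
Lemma rotated_line_affix P E y k Z :
  P <> E -> affix E * (affix E)^* = 1 ->
  affix P - k * (affix P)^* * (affix E * y) = affix E - k * y ->
  line P E Z <-> affix Z - k * (affix E * y) * (affix Z)^* = affix E - k * y.
Proof.
move=> PE xx pE; have d0 : (affix E - affix P)^* != 0.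
  by rewrite conjC_eq0 subr_eq0; apply/eqP => /(affix_inj r_gt0)/esym.
have uE : - (k * (affix E * y)) = - (affix E - affix P) / (affix E - affix P)^*.
  apply: (mulIf d0); rewrite divfK // rmorphB /=.
  apply: (eq_of_diff (eq_addL (eq_mulL (-1) pE) (eq_mulL (- (k * y)) xx))).
  by ring.
apply: (iff_trans (line_affixP r_gt0 Z PE uE)); rewrite -pE; split=> e.
  by apply: (eq_of_diff e); ring.
by apply: (eq_of_diff e); ring.
Qed.

Lemma polar_affixP Z X :
  polar O r Z X <-> affix X * (affix Z)^* + (affix X)^* * affix Z = 2.
Proof.
have := affix_dot O r_gt0 X O Z O; rewrite affix_O !subr0 => ->.
have r20 : r ^+ 2 != 0 by rewrite expf_neq0.
rewrite /polar /=; split=> [->|/(congr1 (@complex.Re K))/= e].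
  by rewrite mulfK // rmorph_nat.
have {}e : 2 * dot (X - O) (Z - O) / r ^+ 2 = 2.
  by rewrite e; simpc.
have n2 : 2 != 0 :> K by rewrite pnatr_eq0.
by apply: (mulfI n2); rewrite -[LHS](divfK r20) e.
Qed.

(** Two points of the polar of [Y] suffice: the inverse [y^*^-1] gives [h1], its translate by
    ['i * y] along the polar gives [h2], and together they yield [x / y = 1]. *)
Lemma polar_inj X Y : Y <> O -> polar O r X = polar O r Y -> X = Y.
Proof.
move=> YO XY; set y := affix Y; set x := affix X.
have y0 : y != 0.
  by apply/eqP; rewrite /y -(affix_O O r) => /(affix_inj r_gt0).
have yc0 : y^* != 0 by rewrite conjC_eq0.
have key z : z * y^* + z^* * y = 2 -> z * x^* + z^* * x = 2.
  have [Z <-] := affix_surj O r_gt0 z.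
  by move=> /polar_affixP; rewrite -XY => /polar_affixP.
have h1 : x^* / y^* + x / y = 2.
  rewrite -(key y^*^-1); last by rewrite fmorphV /= conjCK; field; rewrite y0 yc0.
  by rewrite fmorphV /= conjCK; field; rewrite y0 yc0.
have h2 : x / y = x^* / y^*.
  have := key (y^*^-1 + 'i * y).
  rewrite rmorphD rmorphM fmorphV /= conjCK conjCi => /(_ _)/wrap[].
    by field; rewrite y0 yc0.
  move=> e; apply: (mulfI (neq0Ci _)); apply: (mulfI (mulf_neq0 y0 yc0)).
  apply: (eq_of_diff (eq_addL h1 (eq_mulL (-1) e))); field; rewrite y0 yc0 //.
have n2 : 2 != 0 :> complex K by rewrite pnatr_eq0.
apply: (affix_inj r_gt0 (O := O)); apply: (mulIf (invr_neq0 y0)); apply: (mulfI n2).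
by rewrite -/x -/y divff // mulr1 -[RHS]h1 -h2; ring.
Qed.

(* The polar of the point opposite to [O] on the circle with centre [M]
   through [O]. *)
Definition polar_line M : 'rV[K]_(2 + 1) :=
  row_mx (2 *: (M - O)) (const_mx (- (2 * dot (M - O) O + r ^+ 2))).

Lemma dot_polar_line M q :
  dot (polar_line M) q = 0 <->
  affix M * (proj_affix q)^* + (affix M)^* * proj_affix q = (weight q)%:C%C.
Proof.
have -> : affix M * (proj_affix q)^* + (affix M)^* * proj_affix q =
    ((dot (polar_line M) q) / r ^+ 2 + weight q)%:C%C.
  rewrite dot_block -/(weight q) /polar_line row_mxKl row_mxKr !dot2E.
  rewrite /affix /proj_affix !conj_complex !mxE.
  by simpc; congr Complex; field.
split=> [->|/complexI/eqP]; first by rewrite mul0r add0r.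
rewrite -subr_eq0 addrK mulf_eq0 invr_eq0 expf_eq0 /= (negbTE r_neq0) orbF.
by move/eqP.
Qed.

(** [polar_line M] passes through the three points, so it is a nonzero multiple of [l]. The polars
    of [X] and of the point with affix [2 * affix M] then coincide. *)
Lemma pole_of_join M p1 p2 p3 l X : M <> O ->
  proj_join3 p1 p2 p3 l ->
  dot (polar_line M) p1 = 0 -> dot (polar_line M) p2 = 0 ->
  dot (polar_line M) p3 = 0 -> is_pole O r l X ->
  affix X = 2 * affix M.
Proof.
move=> MO [l0 lP] m1 m2 m3 Xl.
have [a aE] : exists a, polar_line M = a *: l by apply/lP.
have m0 : affix M != 0.
  by apply/eqP; rewrite -(affix_O O r) => /(affix_inj r_gt0).
have a0 : a != 0.
  apply/eqP => a0; apply: MO; apply/eqP; rewrite -subr_eq0.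
  have := congr1 lsubmx aE; rewrite a0 scale0r row_mxKl linear0 => /eqP.
  by rewrite scaler_eq0 pnatr_eq0.
have [Y YE] := affix_surj O r_gt0 (2 * affix M).
rewrite -YE; congr affix; apply: polar_inj.
  move=> YO; move/eqP: YE; rewrite YO affix_O eq_sym mulf_eq0 pnatr_eq0 /=.
  by rewrite (negbTE m0).
rewrite Xl; apply/seteqP; split=> Z.
  move=> lZ; have : dot (polar_line M) (Defs.hom Z) = 0.
    by rewrite aE /dot -scalemxAl mxE [X in _ * X]lZ mulr0.
  move=> /dot_polar_line; rewrite proj_affix_hom weight_hom => e.
  apply/polar_affixP; rewrite YE rmorphM /= rmorph_nat.
  by apply: (eq_of_diff (eq_mulL 2 e)); ring.
move=> /polar_affixP; rewrite YE rmorphM /= rmorph_nat => e.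
have n2 : 2 != 0 :> complex K by rewrite pnatr_eq0.
have : dot (polar_line M) (Defs.hom Z) = 0.
  apply/dot_polar_line; rewrite proj_affix_hom weight_hom; apply: (mulfI n2).
  by apply: (eq_of_diff e); ring.
rewrite aE /dot -scalemxAl mxE => /eqP.
by rewrite mulf_eq0 (negbTE a0) /= => /eqP.
Qed.

End ProjectivePoints.

(** * The rotations of the two Miquel points *)

Section MiquelPair.
Variables (K : realType) (O : 'rV[K]_2) (r : K).
Hypothesis r_gt0 : 0 < r.
Implicit Types A B C P Q M T X : 'rV[K]_2.

Local Notation affix := (affix O r).
Local Notation chord_line := (chord_line O r).

Lemma affix_neq X Y : X != Y -> affix X != affix Y.
Proof. by apply: contra_neq; exact: affix_inj. Qed.

Lemma miquel_circle_affix k P M X : k * k^* = 1 -> 1 - k != 0 ->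
  affix M = affix P / (1 - k) -> miquel_circle k (affix P) (affix X) ->
  circle M (Num.sqrt (dot (O - M) (O - M))) X.
Proof.
move=> kk k1 mE /(miquel_circle_dist kk k1 mE).
rewrite -(affix_O O r) => /(affix_eqdist _ r_gt0) e.
by rewrite /circle /= e sqr_sqrtr // dot2_ge0.
Qed.

Lemma rotated_lines_meet P Q E E' T k :
  P <> E -> Q <> E' ->
  affix E * (affix E)^* = 1 -> affix E' * (affix E')^* = 1 ->
  k * k^* = 1 -> 1 + k != 0 ->
  affix P - k * (affix P)^* * (affix E * affix E') = affix E - k * affix E' ->
  affix Q - k^-1 * (affix Q)^* * (affix E' * affix E) = affix E' - k^-1 * affix E ->
  line P E `&` line Q E' = [set T] ->
  miquel_circle k (affix P) (affix T).
Proof.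
move=> PE QE uE uE' kk k1 pE qE hT.
have [] : (line P E `&` line Q E') T by rewrite hT.
move=> /(rotated_line_affix r_gt0 T PE uE pE) t1.
move=> /(rotated_line_affix r_gt0 T QE uE' qE) t2.
exact: miquel_circle_rotated_lines (unit_neq0 kk) k1 pE t1 t2.
Qed.

(** For [k = 1] both lines would be perpendicular to the side; sharing [T] they would coincide, and
    [P = T = E] would follow. *)
Lemma rotation_neq1 P Q E E' T k :
  P <> E -> Q <> E' ->
  affix E * (affix E)^* = 1 -> affix E' * (affix E')^* = 1 ->
  affix P - k * (affix P)^* * (affix E * affix E') = affix E - k * affix E' ->
  affix Q - k^-1 * (affix Q)^* * (affix E' * affix E) = affix E' - k^-1 * affix E ->
  line P E `&` line Q E' = [set T] ->
  1 - k != 0.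
Proof.
move=> PE QE uE uE' pE qE hT; rewrite subr_eq0; apply/eqP => k1.
have lP Z := rotated_line_affix r_gt0 Z PE uE pE.
have lQ Z := rotated_line_affix r_gt0 Z QE uE' qE.
have [tP tQ] : (line P E `&` line Q E') T by rewrite hT.
move: tP tQ => /lP t1 /lQ; rewrite -k1 invr1 => t2; rewrite -k1 in t1.
have n2 : 2 != 0 :> complex K by rewrite pnatr_eq0.
have EE : affix E = affix E'.
  apply: (mulfI n2); apply: (eq_of_diff (eq_addL t2 (eq_mulL (-1) t1))); ring.
have memQ Z : line P E Z -> Z = T.
  move=> lZ; have : (line P E `&` line Q E') Z.
    by split=> //; apply/lQ; move/lP: lZ; rewrite -k1 invr1 EE.
  by rewrite hT.
by apply: PE; rewrite (memQ P (line_left _ _)) (memQ E (line_right _ _)).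
Qed.

Lemma miquel_point_rotation A B C A1 A2 B1 B2 C1 C2 P :
  anticlockwise A B C ->
  chord_line (line B C) (affix A1) (affix A2) ->
  chord_line (line C A) (affix B1) (affix B2) ->
  chord_line (line A B) (affix C1) (affix C2) ->
  P != A1 -> miquel_point A B C A1 B1 C1 P ->
  exists k, [/\ k * k^* = 1,
    affix P - k * (affix P)^* * (affix A1 * affix A2) = affix A1 - k * affix A2,
    affix P - k * (affix P)^* * (affix B1 * affix B2) = affix B1 - k * affix B2 &
    affix P - k * (affix P)^* * (affix C1 * affix C2) = affix C1 - k * affix C2].
Proof.
move=> hABC chA chB chC PA1 [kA [kB [kC [_ vB vC kP]]]].
have hBCA := anticlockwise_rotate hABC; have hCAB := anticlockwise_rotate hBCA.
have nB := anticlockwise_not_line hBCA; have nC := anticlockwise_not_line hCAB.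
have [[_ kBP] kCP] : (kA `&` kB `&` kC) P by rewrite kP.
have [[ua1 ua2 _] [ub1 _ _] [uc1 _ _]] := And3 chA chB chC.
have eB := vertex_circle_affix r_gt0 nB chC chA vB kBP.
have eC := vertex_circle_affix r_gt0 nC chA chB vC kCP.
exact: miquel_rotation ua1 ua2 ub1 uc1 (affix_neq PA1) eB eC.
Qed.

Lemma miquel_points_opposite A B C A1 A2 B1 B2 C1 C2 P Q k :
  anticlockwise A B C ->
  chord_line (line B C) (affix A1) (affix A2) ->
  chord_line (line C A) (affix B1) (affix B2) ->
  chord_line (line A B) (affix C1) (affix C2) ->
  k != 0 ->
  affix P - k * (affix P)^* * (affix A1 * affix A2) = affix A1 - k * affix A2 ->
  affix P - k * (affix P)^* * (affix B1 * affix B2) = affix B1 - k * affix B2 ->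
  affix P - k * (affix P)^* * (affix C1 * affix C2) = affix C1 - k * affix C2 ->
  Q != A2 -> miquel_point A B C A2 B2 C2 Q ->
  affix Q = - affix P / k /\
  affix Q - k^-1 * (affix Q)^* * (affix A2 * affix A1) =
    affix A2 - k^-1 * affix A1 /\
  affix Q - k^-1 * (affix Q)^* * (affix B2 * affix B1) =
    affix B2 - k^-1 * affix B1 /\
  affix Q - k^-1 * (affix Q)^* * (affix C2 * affix C1) =
    affix C2 - k^-1 * affix C1.
Proof.
move=> hABC chA chB chC k0 pa pb pc QA2 hQ.
(* Exchanging the indices 1 and 2 gives [Q] a rotation [l], to be compared with [k]. *)
have [chA' chB' chC'] := And3 (chord_lineC chA) (chord_lineC chB) (chord_lineC chC).
have [l [_ qa qb qc]] := miquel_point_rotation hABC chA' chB' chC' QA2 hQ.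
have hBCA := anticlockwise_rotate hABC; have hCAB := anticlockwise_rotate hBCA.
have nB := anticlockwise_not_line hBCA; have nC := anticlockwise_not_line hCAB.
(* The centres of the circles at [B] and [C] show that the determinant is nonzero. *)
have [kA [kB [kC [_ vB vC _]]]] := hQ.
have [M [_ [_ _ mc ma]]] := vertex_circle_center r_gt0 chC' chA' vB.
have [N [_ [_ _ na nb]]] := vertex_circle_center r_gt0 chA' chB' vC.
have hb := chord_lines_not_parallel nC chA chB; rewrite eq_sym in hb.
have hc := chord_lines_not_parallel nB chC chA.
have bc : affix B != affix C.
  by apply: affix_neq; apply/eqP/(anticlockwise_neq hBCA).
have det := pencil_det_neq0 hb hc bc mc ma na nb.
have [qE lE] := miquel_opposite k0 det pa pb pc qa qb qc.
by split=> //; rewrite -lE.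
Qed.

End MiquelPair.

(** * The ten points on one circle *)

Theorem theorem3p1 (K : realType)
  (A B C O A1 A2 B1 B2 C1 C2 P Q TA TB TC A' B' C' R : 'rV[K]_2) (r : K)
  (A0 B0 C0 l : 'rV[K]_(2 + 1))
  (hABC : anticlockwise A B C)
  (hr : 0 < r)
  (hA12 : circle O r `&` line B C = [set A1; A2])
  (hB12 : circle O r `&` line C A = [set B1; B2])
  (hC12 : circle O r `&` line A B = [set C1; C2])
  (hnA1 : ~ (A = B1 /\ A = C1)) (hnA2 : ~ (A = B2 /\ A = C2))
  (hnB1 : ~ (B = C1 /\ B = A1)) (hnB2 : ~ (B = C2 /\ B = A2))
  (hnC1 : ~ (C = A1 /\ C = B1)) (hnC2 : ~ (C = A2 /\ C = B2))
  (hP : miquel_point A B C A1 B1 C1 P)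
  (hQ : miquel_point A B C A2 B2 C2 Q)
  (hPQ : P <> Q)
  (hP1 : P \notin [:: A1; B1; C1])
  (hQ2 : Q \notin [:: A2; B2; C2])
  (hTA : line P A1 `&` line Q A2 = [set TA])
  (hTB : line P B1 `&` line Q B2 = [set TB])
  (hTC : line P C1 `&` line Q C2 = [set TC])
  (hA' : second_intersection A B C B1 C1 B2 C2 A')
  (hB' : second_intersection B C A C1 A1 C2 A2 B')
  (hC' : second_intersection C A B A1 B1 A2 B2 C')
  (hA0 : chord_meet (circle O r) B1 C2 C1 B2 A0)
  (hB0 : chord_meet (circle O r) A1 C2 C1 A2 B0)
  (hC0 : chord_meet (circle O r) A1 B2 B1 A2 C0)
  (hl : proj_join3 A0 B0 C0 l)
  (hl_fin : ~ at_infinity l)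
  (hlO : ~ affine_part l O)
  (hR : is_pole O r l R) :
  exists k : set 'rV[K]_2,
    is_circle k /\ [set P; Q; O; R; A'; B'; C'; TA; TB; TC] `<=` k.
Proof.
have hBCA := anticlockwise_rotate hABC; have hCAB := anticlockwise_rotate hBCA.
have [nA nB nC] := And3 (anticlockwise_not_line hABC)
  (anticlockwise_not_line hBCA) (anticlockwise_not_line hCAB).
have chA := side_chord_line hr (anticlockwise_neq hBCA) hA12.
have chB := side_chord_line hr (anticlockwise_neq hCAB) hB12.
have chC := side_chord_line hr (anticlockwise_neq hABC) hC12.
have [[ua1 ua2 _] [ub1 ub2 _] [uc1 uc2 _]] := And3 chA chB chC.
move: hP1 hQ2; rewrite !inE !negb_or => /and3P[PA1 PB1 PC1] /and3P[QA2 QB2 QC2].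
have [k [kk pa pb pc]] := miquel_point_rotation hr hABC chA chB chC PA1 hP.
have k0 := unit_neq0 kk.
have [qE [qa [qb qc]]] :=
  miquel_points_opposite hr hABC chA chB chC k0 pa pb pc QA2 hQ.
have [NA xA] := second_intersection_affix hr nA chB chC hA'.
have [NB xB] := second_intersection_affix hr nB chC chA hB'.
have [NC xC] := second_intersection_affix hr nC chA chB hC'.
have [gA1 gA2] : circle O r A1 /\ circle O r A2 by split; apply/(circle_affixP _ hr).
have [gB1 gB2] : circle O r B1 /\ circle O r B2 by split; apply/(circle_affixP _ hr).
have [gC1 gC2] : circle O r C1 /\ circle O r C2 by split; apply/(circle_affixP _ hr).
have [A0l A0m] := chord_meet_proj_affix hr gB1 gC2 gC1 gB2 hA0.
have [B0l B0m] := chord_meet_proj_affix hr gA1 gC2 gC1 gA2 hB0.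
have [C0l C0m] := chord_meet_proj_affix hr gA1 gB2 gB1 gA2 hC0.
have lA := chord_meet_eq NA pb pc A0l A0m.
(* In cyclic order the chord [C1 A2] comes first, hence the exchanged equations of [B0]. *)
have lB := chord_meet_eq NB pc pa B0m B0l.
have lC := chord_meet_eq NC pa pb C0l C0m.
have [PA1' PB1' PC1'] := And3 (elimN eqP PA1) (elimN eqP PB1) (elimN eqP PC1).
have [QA2' QB2' QC2'] := And3 (elimN eqP QA2) (elimN eqP QB2) (elimN eqP QC2).
have k1 := rotation_neq1 hr PA1' QA2' ua1 ua2 pa qa hTA.
have k2 : 1 + k != 0.
  rewrite addrC addr_eq0; apply/eqP => kE; apply: hPQ; apply: (affix_inj hr (O := O)).
  by rewrite qE kE invrN1 mulrN1 opprK.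
have [M mE] := affix_surj O hr (affix O r P / (1 - k)).
have onM X := miquel_circle_affix hr (X := X) kk k1 mE.
(* Otherwise [P] would be [O], and by [qE] so would [Q]. *)
have MO : M <> O.
  move=> MO; apply: hPQ; apply: (affix_inj hr (O := O)); rewrite qE.
  have -> : affix O r P = 0 by rewrite -(divfK k1 (affix O r P)) -mE MO affix_O mul0r.
  by rewrite oppr0 mul0r.
have conjm := miquel_center_conj kk k1 mE.
(* Divided by [1 - k], the relations [lA], [lB], [lC] become incidence with the polar of the
   antipode of [O]. *)
have onl q : (1 - k) * (weight q)%:C%C = affix O r P * (proj_affix O r q)^* -
    k * (affix O r P)^* * proj_affix O r q -> dot (polar_line O r M) q = 0.
  move=> e; apply/(dot_polar_line O hr); rewrite conjm mE.
  by apply: (eq_of_diff (eq_mulL (- (1 - k)^-1) e)); field.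
have RE := pole_of_join hr MO hl (onl _ lA) (onl _ lB) (onl _ lC) hR.
exists (circle M (Num.sqrt (dot (O - M) (O - M)))); split.
  exists M, (Num.sqrt (dot (O - M) (O - M))); split=> //.
  rewrite sqrtr_gt0 lt0r dot2_ge0 andbT; apply/eqP => /dot2_eq0/eqP.
  by rewrite subr_eq0 => /eqP/esym.
move=> X [[[[[[[[[|]|]|]|]|]|]|]|]|] ->; apply: onM.
- by rewrite /miquel_circle; ring.
- rewrite /miquel_circle qE rmorphM rmorphN fmorphV /= (unit_conjC kk) invrK.
  by field.
- by rewrite /miquel_circle affix_O rmorph0 !(mul0r, mulr0) subrr.
- rewrite /miquel_circle RE rmorphM /= conjm mE rmorph_nat.
  by field.
- exact: miquel_circle_second_intersection ub1 ub2 uc1 uc2 pb pc NA xA.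
- exact: miquel_circle_second_intersection uc1 uc2 ua1 ua2 pc pa NB xB.
- exact: miquel_circle_second_intersection ua1 ua2 ub1 ub2 pa pb NC xC.
- exact (rotated_lines_meet hr PA1' QA2' ua1 ua2 kk k2 pa qa hTA).
- exact (rotated_lines_meet hr PB1' QB2' ub1 ub2 kk k2 pb qb hTB).
- exact (rotated_lines_meet hr PC1' QC2' uc1 uc2 kk k2 pc qc hTC).
Qed.
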